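(* Two bar strings $v,w\in\overline{\mathbb A}^*$ are $\alpha$-equivalent if and only if $\mathsf{nf}(v)=\mathsf{nf}(w)$.
   Context: $\mathbb A$ is a fixed countably infinite set of names; $\overline{\mathbb A}=\mathbb A\cup\{\vert a : a\in\mathbb A\}$, where $a$ is a plain name and $\vert a$ a bar name. A bar string is a finite word over $\overline{\mathbb A}$. Finite permutations $\pi$ of $\mathbb A$ act by $\pi\cdot a=\pi(a)$, $\pi\cdot\vert a=\vert\pi(a)$, and letterwise on words; $(a\ c)$ is the transposition of $a$ and $c$. For bar strings $v,u$ write $\langle a\rangle v=\langle b\rangle u$ iff $(a\ c)\cdot v=(b\ c)\cdot u$ for some (equivalently every) name $c\notin\{a,b\}$ not occurring (plain or barred) in $v$ or $u$. $\alpha$-equivalence $\equiv_\alpha$ on bar strings is the equivalence relation generated by $w\vert a\,v\equiv_\alpha w\vert b\,u$ whenever $\langle a\rangle v=\langle b\rangle u$. De Bruijn normal form: for $w=\alpha_1\cdots\alpha_n\in\overline{\mathbb A}^*$, $\mathsf{nf}(w)=\beta_1\cdots\beta_n\in(\mathbb A+\mathbb N)^*$ (disjoint union) is defined inductively by: (1) $\beta_i=\alpha_i$ if $\alpha_i\in\mathbb A$ and $\alpha_i$ is not preceded by any occurrence of $\vert\alpha_i$ in $w$; (2) $\beta_i=k$ if $\alpha_i\in\mathbb A$ and $\beta_j=k$ where $j=\max\{j<i:\alpha_j=\vert\alpha_i\}$; (3) $\beta_i=k+1$ if $\alpha_i$ is a bar name and $\alpha_1\cdots\alpha_{i-1}$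 contains $k$ (occurrences of) bar names. *)

(* Defs.v *)
From HB Require Import structures.
From mathcomp Require Import all_boot.
From Stdlib Require Import Relation_Operators.

Set Implicit Arguments.
Unset Strict Implicit.
Unset Printing Implicit Defensive.

Inductive letter (A : Type) : Type := Plain of A | Bar of A.

Section LetterEq.
Variable A : eqType.

Definition letter_to_sum (x : letter A) : A + A :=
  match x with Plain a => inl a | Bar a => inr a end.
Definition letter_of_sum (s : A + A) : letter A :=
  match s with inl a => Plain a | inr a => Bar a end.
Lemma letter_to_sumK : cancel letter_to_sum letter_of_sum.
Proof. by case. Qed.

HB.instance Definition _ := Equality.copy (letter A) (can_type letter_to_sumK).
End LetterEq.

Definition barstring (A : Type) : Type := seq (letter A).

(* No finite sequence exhausts A. *)
Definition infinite_type (A : eqType) : Prop :=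
  forall s : seq A, exists a : A, a \notin s.

Section BarStrings.
Variable A : eqType.
Implicit Types (a b c x : A) (v w u : barstring A).

(* [tperm] of MathComp is only available on finite types. *)
Definition transp a c x : A :=
  if x == a then c else if x == c then a else x.

Definition act_letter (pi : A -> A) (l : letter A) : letter A :=
  match l with Plain a => Plain (pi a) | Bar a => Bar (pi a) end.

Definition act (pi : A -> A) w : barstring A := map (act_letter pi) w.

Definition fresh c w : bool := (Plain c \notin w) && (Bar c \notin w).

(* <a>v = <b>u *)
Definition abs_eq a v b u : Prop :=
  exists c, [/\ c != a, c != b, fresh c v, fresh c u &
                act (transp a c) v = act (transp b c) u].

Inductive alpha_step : barstring A -> barstring A -> Prop :=
  AlphaStep w a v b u of abs_eq a v b u :
    alpha_step (w ++ Bar a :: v) (w ++ Bar b :: u).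

Definition alpha_equiv : barstring A -> barstring A -> Prop :=
  clos_refl_sym_trans (barstring A) alpha_step.

Definition is_bar (l : letter A) : bool := if l is Bar _ then true else false.

(* [pre] lists the pairs (alpha_j, beta_j), j < i, with the most recent one
   first, so that the first pair with alpha_j = Bar a is the one with the
   largest such index j. *)
Definition nf_letter (pre : seq (letter A * (A + nat))) (l : letter A) :
    A + nat :=
  match l with
  | Plain a =>
      if [seq p.2 | p <- pre & p.1 == Bar a] is beta :: _ then beta else inl a
  | Bar _ => inr (count (fun p => is_bar p.1) pre).+1
  end.

Fixpoint nf_from (pre : seq (letter A * (A + nat))) w : seq (A + nat) :=
  if w is l :: w' then
    let beta := nf_letter pre l in beta :: nf_from ((l, beta) :: pre) w'
  else [::].

Definition nf w : seq (A + nat) := nf_from [::] w.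

End BarStrings.

(* Main.v *)
From Stdlib Require Import Relation_Operators.
Require Import Defs.
From mathcomp Require Import all_boot.

(** The normal form is computed by a left-to-right traversal that carries the
    current value [f a] of each plain name [a] and the number [k] of bar names
    read so far.  Renaming a bound [a] to a fresh [c] amounts to precomposing
    [f] with the transposition, which leaves the output unchanged; this gives
    soundness.  For completeness, two strings with the same output under an
    injective [f] are compared letter by letter: plain names agree by
    injectivity, and at a pair of bar names both binders are renamed to a common
    fresh name. *)

Set Implicit Arguments.
Unset Strict Implicit.
Unset Printing Implicit Defensive.

Section NormalForm.
Variable A : eqType.
Implicit Types (a b c x : A) (v w u : barstring A) (f : A -> A + nat).

Definition name_of (l : letter A) : A :=
  match l with Plain a => a | Bar a => a end.

Definition names w : seq A := map name_of w.

Lemma freshE c w : fresh c w = (c \notin names w).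
Proof.
rewrite /fresh; elim: w => //= l w IH; rewrite !in_cons !negb_or -IH andbACA.
by congr (_ && _); case: l => b; rewrite ?andbT.
Qed.

Lemma transpK a c : involutive (transp a c).
Proof.
move=> x; rewrite /transp; have [->|xa] := eqVneq x a.
  by rewrite eqxx; case: eqVneq.
by have [->|xc] := eqVneq x c; rewrite ?eqxx // (negPf xa) (negPf xc).
Qed.

Lemma eq_in_act (p q : A -> A) w : {in names w, p =1 q} -> act p w = act q w.
Proof.
move=> pq; apply/eq_in_map => l lw.
by have := pq _ (map_f name_of lw); case: l {lw} => a /= ->.
Qed.

Lemma act_comp (p q : A -> A) w : act p (act q w) = act (p \o q) w.
Proof. by rewrite /act -map_comp; apply: eq_map; case. Qed.

Definition upd f a (y : A + nat) : A -> A + nat :=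
  fun x => if x == a then y else f x.

Fixpoint nf_env f (k : nat) w : seq (A + nat) :=
  match w with
  | [::] => [::]
  | Plain a :: w' => f a :: nf_env f k w'
  | Bar a :: w' => inr k.+1 :: nf_env (upd f a (inr k.+1)) k.+1 w'
  end.

Lemma eq_in_nf_env f g k w :
  {in names w, f =1 g} -> nf_env f k w = nf_env g k w.
Proof.
elim: w f g k => //= -[] a w IH f g k fg; congr (_ :: _).
- by apply: fg; rewrite inE eqxx.
- by apply: IH => x xw; apply: fg; rewrite inE xw orbT.
- apply: IH => x xw; rewrite /upd; case: ifP => // _.
  by apply: fg; rewrite inE xw orbT.
Qed.

Lemma nf_env_act f k (p : A -> A) w :
  injective p -> nf_env f k (act p w) = nf_env (f \o p) k w.
Proof.
move=> p_inj; elim: w f k => //= -[] a w IH f k /=; rewrite IH //.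
congr (_ :: _); apply: eq_in_nf_env => x _.
by rewrite /= /upd (inj_eq p_inj).
Qed.

(** Precomposing [upd f c y] with the transposition gives [y] at [a] and [f x] at every other [x]
    except [c], where the two environments may differ; freshness keeps [c] out of [w]. *)
Lemma nf_env_rename f k a c y w : fresh c w ->
  nf_env (upd f c y) k (act (transp a c) w) = nf_env (upd f a y) k w.
Proof.
rewrite freshE => cw; rewrite nf_env_act; last exact: inv_inj (transpK a c).
apply: eq_in_nf_env => x xw /=; rewrite /upd /transp.
have xc : x != c by apply: contraNneq cw => <-.
by have [_|xa] := eqVneq x a; rewrite ?eqxx // (negPf xc) (negPf xc).
Qed.

(** Pushing a bar letter onto [pre] changes the lookup function exactly as [upd] does; pushing a
    plain letter leaves it unchanged. *)
Lemma nf_fromE pre w :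
  nf_from pre w =
  nf_env (fun a => nf_letter pre (Plain a)) (count (fun p => is_bar p.1) pre) w.
Proof.
elim: w pre => //= -[] a w IH pre; rewrite IH; congr (_ :: _).
rewrite /= add1n; apply: eq_in_nf_env => x _; rewrite /upd /=.
have -> : (Bar a == Bar x) = (x == a).
  by apply/eqP/eqP => [[->]|->].
by case: eqP.
Qed.

Lemma nfE w : nf w = nf_env inl 0 w.
Proof. exact: nf_fromE. Qed.

Lemma nf_env_alpha_step f k v w :
  alpha_step v w -> nf_env f k v = nf_env f k w.
Proof.
case=> p a v' b u [c [_ _ cv cu e]].
elim: p f k => [|[] x p IH] f k /=; rewrite ?IH //.
by rewrite -(nf_env_rename _ _ a _ cv) e nf_env_rename.
Qed.

Lemma alpha_equiv_cons l v w : alpha_equiv v w -> alpha_equiv (l :: v) (l :: w).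
Proof.
elim=> [x y [p a v' b u e]|x|x y _ IH|x y z _ IHxy _ IHyz].
- exact/rst_step/(AlphaStep (l :: p) e).
- exact: rst_refl.
- exact: rst_sym.
- exact: rst_trans IHxy IHyz.
Qed.

(** [abs_eq] demands a name distinct from both binders, so [c] itself cannot be the witness. A
    further fresh [d] serves: on the names of [v], swapping [a] with [c] and then [c] with [d]
    agrees with swapping [a] with [d]. *)
Lemma alpha_equiv_rename (infA : infinite_type A) a c v : c != a -> fresh c v ->
  alpha_equiv (Bar a :: v) (Bar c :: act (transp a c) v).
Proof.
rewrite freshE => ca cv; apply/rst_step/(AlphaStep [::]).
have [d] := infA [:: a, c & names v ++ names (act (transp a c) v)].
rewrite !inE mem_cat !negb_or => /and4P[da dc dv dv'].
exists d; split; rewrite ?freshE //; rewrite act_comp.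
apply: eq_in_act => x xv /=.
have xc : x != c by apply: contraNneq cv => <-.
have xd : x != d by apply: contraNneq dv => <-.
rewrite /transp; have [_|xa] := eqVneq x a; first by rewrite eqxx.
by rewrite !(negPf xc) (negPf xd).
Qed.

(* The bound on the indices in the range of [f] makes [k.+1] new, so that
   injectivity survives the update at a binder. *)
Lemma alpha_equiv_nf_env (infA : infinite_type A) f k v w :
  injective f -> (forall a n, f a = inr n -> n <= k) ->
  nf_env f k v = nf_env f k w -> alpha_equiv v w.
Proof.
(* Renaming the body breaks structural induction on [v], so the induction runs on the output [s],
   which the renaming preserves. *)
move=> f_inj f_le; have [s] : exists s, nf_env f k v = s by eexists.
elim: s f k v w f_inj f_le => [|y s IH] f k v w f_inj f_le.
  case: v => [|[]] //; case: w => [|[]] // *; exact: rst_refl.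
case: v => [|[] a v] //= [_ sv]; case: w => [|[] b w] //= [].
- move=> /f_inj -> e; apply: alpha_equiv_cons; exact: IH sv e.
(* A plain name cannot face a bar name: its value would be the index [k.+1], above the bound [k]. *)
- by move=> /f_le; rewrite ltnn.
- by move=> /esym/f_le; rewrite ltnn.
have [c] := infA [:: a, b & names v ++ names w].
rewrite !inE mem_cat !negb_or -!freshE => /and4P[ca cb cv cw].
rewrite -(nf_env_rename _ _ a _ cv) in sv *.
rewrite -(nf_env_rename _ _ b _ cw) => e.
apply: rst_trans (alpha_equiv_rename infA ca cv) _.
apply: rst_trans (rst_sym _ _ _ _ (alpha_equiv_rename infA cb cw)).
apply: alpha_equiv_cons; apply: IH sv e => [x z|x n]; rewrite /upd.
- have [->|_] := eqVneq x c; have [->|_] := eqVneq z c => //.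
  + by move=> /esym/f_le; rewrite ltnn.
  + by move=> /f_le; rewrite ltnn.
  + exact: f_inj.
- by case: eqP => [_ [<-]|_ /f_le/leqW].
Qed.

End NormalForm.

Theorem proposition4p3 (A : countType) (infA : infinite_type A)
    (v w : barstring A) :
  alpha_equiv v w <-> nf v = nf w.
Proof.
rewrite !nfE; split=> [|e].
- by elim=> [x y /nf_env_alpha_step||x y _ ->|x y z _ -> _ ->].
- by apply: alpha_equiv_nf_env e => // a b [].
Qed.
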